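(* Let $E$ be a Banach space, $-\infty<a<b<\infty$, and let $\Lambda$ be a well ordered subset of $[a,b]$ with $\min\Lambda=a$ and $\max\Lambda=b$ such that $[a,b)$ is the union of the disjoint intervals $[\alpha,S(\alpha))$, $\alpha\in\Lambda^{<b}$. Let $(z_\alpha)_{\alpha\in\Lambda}$ be a family in $E$ and let $g:[a,b]\to E$ satisfy $$g(t)=z_\alpha,\quad t\in[\alpha,S(\alpha)),\ \alpha\in\Lambda^{<b}.$$ Then the following conditions are equivalent: (a) $g$ is HL integrable. (b) The family $((S(\alpha)-\alpha)z_\alpha)_{\alpha\in\Lambda^{<b}}$ is summable. If (a) or (b) holds, then $\int_a^bg(t)\,dt$ is the sum of the family $((S(\alpha)-\alpha)z_\alpha)_{\alpha\in\Lambda^{<b}}$.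
   Context: A subset $\Lambda$ of $\mathbb R\cup\{\infty\}$ is well ordered if each of its nonempty subsets has a smallest element. For $\beta\in\Lambda$ different from a possible maximum of $\Lambda$, $S(\beta)$ is the smallest element of $\Lambda$ greater than $\beta$ (the successor of $\beta$). $\Lambda^{<\gamma}=\{\alpha\in\Lambda:\alpha<\gamma\}$. In the claim, the numbers $S(\alpha)$ are successors in $\Lambda$. Let $\Gamma$ be a nonempty well ordered subset of $\mathbb R\cup\{\infty\}$, $m=\min\Gamma$, $s=\sup\Gamma$. A family $(x_\alpha)_{\alpha\in\Gamma}$ in a normed space $E$ is summable if to every $\gamma\in\Gamma\cup\{s\}$ there corresponds a unique element $\sigma(\gamma)\in E$ (the sum of $(x_\alpha)_{\alpha\in\Gamma^{<\gamma}}$) such that: (i) $\sigma(m)=0$, and if $\gamma$ is the successor in $\Gamma$ of some $\beta\in\Gamma$, then $\sigma(\gamma)=\sigma(\beta)+x_\beta$; (ii) if $\gamma>m$ is not a successor, then for each $\epsilon>0$ there is $\beta_\epsilon\in\Gamma^{<\gamma}$ such that $\|\sigma(\beta)-\sigma(\gamma)\|<\epsilon$ whenever $\beta\in\Gamma$ and $\beta_\epsilon\le\beta<\gamma$. The sum of a summable family $(x_\alpha)_{\alpha\in\Gamma}$ is $\sigma(s)$ if $s\notin\Gamma$, and $\sigma(s)+x_s$ if $s\in\Gamma$. A mapping $g:[a,b]\to E$ is HL (Henstock–Lebesgue) integrable if there is a mapping $f:[a,b]\to E$ such that for each $\epsilon>0$ there is $\delta:[a,b]\to(0,\infty)$ such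 that whenever $a=t_0<\dots<t_m=b$ and $\xi_i\in[t_{i-1},t_i]\subset(\xi_i-\delta(\xi_i),\xi_i+\delta(\xi_i))$ for $i=1,\dots,m$, then $\sum_{i=1}^m\|f(t_i)-f(t_{i-1})-g(\xi_i)(t_i-t_{i-1})\|<\epsilon$. Then $\int_c^dg(s)\,ds:=f(d)-f(c)$. *)

(* Defs.v *)
From HB Require Import structures.
From mathcomp Require Import all_boot all_order all_algebra.
From mathcomp Require Import all_classical all_reals all_analysis.

Set Implicit Arguments.
Unset Strict Implicit.
Unset Printing Implicit Defensive.

Import Order.TTheory GRing.Theory Num.Theory.
Import numFieldNormedType.Exports.

Local Open Scope classical_set_scope.
Local Open Scope ring_scope.

(* Subsets of R `|` {+oo} are represented as sets of extended reals that do not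
   contain -oo. *)
Section WellOrdered.
Context {R : realType}.
Implicit Types (A : set (\bar R)) (x y : \bar R).

Definition least A x := A x /\ lbound A x.

Definition greatest A x := A x /\ ubound A x.

Definition well_ordered A :=
  ~ A -oo%E /\
  forall B, B `<=` A -> B !=set0 -> exists x, least B x.

Definition above A x : set (\bar R) := [set y | A y /\ (x < y)%E].

Definition below A x : set (\bar R) := [set y | A y /\ (y < x)%E].

Definition is_succ A x y := A x /\ least (above A x) y.

(* The value is only meaningful when x is in A and is not the maximum of A. *)
Definition succ A x : \bar R := xget +oo%E (is_succ A x).

End WellOrdered.

(* A family indexed by G is a function on the extended reals of which only the
   values on G are used. *)
Section Summable.
Context {R : realType} {E : normedModType R}.
Implicit Types (G : set (\bar R)) (x sigma : \bar R -> E).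

Definition is_partial_sums G x sigma :=
  [/\ (forall m, least G m -> sigma m = 0),
      (forall beta gamma, is_succ G beta gamma ->
         sigma gamma = sigma beta + x beta) &
      (forall gamma m, (G `|` [set ereal_sup G]) gamma ->
         least G m -> (m < gamma)%E ->
         ~ (exists beta, is_succ G beta gamma) ->
         forall eps : R, 0 < eps ->
         exists2 beta_eps, below G gamma beta_eps &
           forall beta, G beta -> (beta_eps <= beta)%E -> (beta < gamma)%E ->
             `|sigma beta - sigma gamma| < eps)].

Definition wo_summable G x :=
  exists2 sigma, is_partial_sums G x sigma &
    forall sigma', is_partial_sums G x sigma' ->
      {in G `|` [set ereal_sup G], sigma' =1 sigma}.

Definition partial_sum G x : \bar R -> E :=
  xget (fun=> 0) (is_partial_sums G x).

Definition wo_sum G x : E :=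
  let s := ereal_sup G in
  if s \in G then partial_sum G x s + x s else partial_sum G x s.

End Summable.

(* A map defined on [a, b] is a function on R of which only the values on
   [a, b] are used. *)
Section HenstockLebesgue.
Context {R : realType} {E : normedModType R}.
Implicit Types (a b c d : R) (f g : R -> E).

(* The points of the partition are a :: s, and xi i is the tag of its
   (i+1)-st interval. *)
Definition is_fine_tagged_partition a b (delta : R -> R) (s : seq R)
    (xi : nat -> R) :=
  let t := nth b (a :: s) in
  itv_partition a b s /\
  forall i, (i < size s)%N ->
    t i <= xi i <= t i.+1 /\
    `[t i, t i.+1] `<=` `](xi i - delta (xi i)), (xi i + delta (xi i))[.

Definition is_HL_primitive a b g f :=
  forall eps : R, 0 < eps ->
  exists2 delta : R -> R, (forall t, a <= t <= b -> 0 < delta t) &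
    forall (s : seq R) (xi : nat -> R),
      is_fine_tagged_partition a b delta s xi ->
      let t := nth b (a :: s) in
      \sum_(i < size s)
        `|f (t i.+1) - f (t i) - (t i.+1 - t i) *: g (xi i)| < eps.

Definition HL_integrable a b g := exists f, is_HL_primitive a b g f.

(* Integral from c to d of a map g that is integrable on [a, b]; two primitives
   of g differ by a constant on [a, b], so the choice of f is immaterial. *)
Definition HL_integral a b g c d : E :=
  let f := xget (fun=> 0) (is_HL_primitive a b g) in
  f d - f c.

End HenstockLebesgue.

(* Main.v *)
Require Import Defs.
From HB Require Import structures.
From mathcomp Require Import all_boot all_order all_algebra.
From mathcomp Require Import all_classical all_reals all_analysis.
From mathcomp Require Import ring lra.

Import Order.TTheory GRing.Theory Num.Theory.
Import numFieldNormedType.Exports.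

Local Open Scope classical_set_scope.
Local Open Scope ring_scope.

Set Implicit Arguments.
Unset Strict Implicit.
Unset Printing Implicit Defensive.

(** * Proof idea

Both conditions speak about the same object: a map f on [a, b] that increases by
(S(alpha) - alpha) z_alpha over [alpha, S(alpha)] and is continuous.

Suppose that f is a primitive of g. On [alpha, S(alpha)] the map g is
constant except perhaps at the right end, so f has the same increment there as the
affine primitive of that constant (HL_primitive_constant,
HL_primitive_incr_unique). Moreover f is continuous from the left
(HL_primitive_left_continuous), and an element of Lambda that is neither a nor
a successor is approached from the left by elements of Lambda, because the
intervals [alpha, S(alpha)) cover [a, b). Hence the numbers f(gamma) - f(a) satisfy
the recursion that defines the partial sums (partial_sums_of_primitive).

Conversely, let tau(gamma) be partial sums. Interpolate them affinely with slope
z_alpha on [alpha, S(alpha)). The resulting f is continuous on [a, b]; the point to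
check is the left-hand limit at a limit element, where f(u) is on the segment between two
consecutive partial sums and both are close to tau(gamma). Off Lambda, f has
derivative g. As Lambda is countable, f is a primitive of g
(HL_primitive_of_derivative): a tag in the exceptional set contributes little by
continuity, and these contributions are bounded by a geometric series because each
point tags at most two intervals of a partition.

The sums in the statement are indexed by the elements of Lambda below b, whose
supremum is either b or the predecessor of b. In both cases partial sums extend to
b, and the value at b is the sum of the family (partial_sums_below,
partial_sums_extend), so the argument above is carried out on Lambda itself.
Uniqueness of partial sums by transfinite induction (partial_sums_unique) then gives
summability and identifies the sum with f(b) - f(a) for every primitive f.

That fine partitions exist at all is Cousin's lemma (cousin). Extending a fine
partition of [c, d] to one of [a, b] shows that a gauge for [a, b] serves every
subinterval with the same bound (saks_henstock); this is what localizes
the definition of the integral. *)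

(** * Fine tagged partitions *)

Section FinePartitions.
Context {R : realType}.
Implicit Types (a b c d : R) (delta : R -> R) (s : seq R) (xi : nat -> R).

Definition cat_tags s1 xi1 xi2 : nat -> R :=
  fun i => if (i < size s1)%N then xi1 i else xi2 (i - size s1)%N.

(** Partition points are read with the right end as default value, so the default
changes when two partitions are glued; this and the next lemma absorb the change. *)
Lemma nth_cat_partitionL a c d s1 s2 i : (i <= size s1)%N ->
  nth d (a :: s1 ++ s2) i = nth c (a :: s1) i.
Proof.
by move=> i1; rewrite -cat_cons nth_cat/= ltnS i1; apply: set_nth_default.
Qed.

Lemma nth_cat_partitionR a c d s1 s2 i : last a s1 = c ->
  nth d (a :: s1 ++ s2) (size s1 + i) = nth d (c :: s2) i.
Proof.
move=> l1; rewrite -cat_cons nth_cat/=; case: i => [|i].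
  by rewrite addn0 ltnS leqnn /= -l1 (last_nth d).
by rewrite ltnS addnS leqNgt ltnS leq_addr/= subSS addKn.
Qed.

Lemma fine_partition_nil delta xi a :
  is_fine_tagged_partition a a delta [::] xi.
Proof. by split=> //; split=> //=. Qed.

Lemma fine_partition1 delta a b t : a < b -> a <= t <= b ->
  t - delta t < a -> b < t + delta t ->
  is_fine_tagged_partition a b delta [:: b] (fun=> t).
Proof.
move=> ab atb ta bt; split; first exact: itv_partition1.
case=> [|//] _ /=; split=> // u /=; rewrite !in_itv/= => /andP[au ub].
by rewrite (lt_le_trans ta)//= (le_lt_trans ub).
Qed.

Lemma fine_partition_cat delta a c d s1 s2 xi1 xi2 :
  is_fine_tagged_partition a c delta s1 xi1 ->
  is_fine_tagged_partition c d delta s2 xi2 ->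
  is_fine_tagged_partition a d delta (s1 ++ s2) (cat_tags s1 xi1 xi2).
Proof.
move=> [p1 f1] [p2 f2]; split; first exact: itv_partition_cat p1 p2.
have l1 : last a s1 = c by case: p1 => _ /eqP.
move=> i; rewrite size_cat /cat_tags => i12; case: ltnP => i1.
  by rewrite !(nth_cat_partitionL _ c)//; [exact: f1|exact: ltnW].
rewrite -(subnKC i1) -addnS !(nth_cat_partitionR _ _ _ l1) addKn.
by apply: f2; rewrite ltn_subLR.
Qed.

Definition has_fine_partition delta a b :=
  exists s xi, is_fine_tagged_partition a b delta s xi.

Lemma has_fine_partition_step delta a u v t : has_fine_partition delta a u ->
  u <= t <= v -> t - delta t < u -> v < t + delta t ->
  has_fine_partition delta a v.
Proof.
move=> [s [xi p]] utv tu vt; have [<-|uv] := eqVneq u v; first by exists s, xi.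
have {}uv : u < v by rewrite lt_neqAle uv (le_trans (andP utv).1 (andP utv).2).
exists (s ++ [:: v]), (cat_tags s xi (fun=> t)).
by apply: (fine_partition_cat p); apply: fine_partition1.
Qed.

(** Cousin's lemma. Let y be the supremum of the points up to which a fine partition
exists. The gauge at y lets one interval tagged by y start at such a point left of
y and end anywhere slightly to the right of y, so y itself is reached and, if
y < b, so is a larger point. *)
Lemma cousin delta a b : a <= b -> (forall t, a <= t <= b -> 0 < delta t) ->
  has_fine_partition delta a b.
Proof.
move=> ab delta0; pose A := [set x | a <= x <= b /\ has_fine_partition delta a x].
have Aa : A a.
  by rewrite /A/= lexx ab; split=> //; exists [::], (fun=> a);
  exact: fine_partition_nil.
have supA : has_sup A by split; [exists a|exists b => x [/andP[]]].
pose y := sup A.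
have yab : a <= y <= b.
  by rewrite (sup_ubound supA.2 Aa)/= ge_sup//; [exists a|move=> x [/andP[]]].
have dy := delta0 _ yab.
have [x Ax yx] := sup_adherent dy supA.
have [/andP[ax xb] px] := Ax.
have xy : x <= y by exact: (sup_ubound supA.2 Ax).
have py v : y <= v -> v < y + delta y -> has_fine_partition delta a v.
  by move=> yv vy; apply: (has_fine_partition_step (t := y) px) => //; rewrite xy.
have [yb|yb] := ltP y b; last by apply: py => //; move: (andP yab).2 => ?; lra.
pose v := Num.min b (y + delta y / 2).
have yv : y < v by rewrite lt_min yb/=; lra.
have vy : v < y + delta y by rewrite gt_min; apply/orP; right; lra.
have : A v.
  split; last by apply: py => //; exact: ltW.
  by rewrite (le_trans (andP yab).1 (ltW yv))/= ge_min lexx.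
by move=> /(sup_ubound supA.2); rewrite leNgt yv.
Qed.

End FinePartitions.

(** * Primitives in the sense of Henstock and Lebesgue *)

Section Primitives.
Context {R : realType} {E : normedModType R}.
Implicit Types (a b c d eps : R) (delta : R -> R) (s : seq R) (xi : nat -> R).
Implicit Types f g : R -> E.

Definition HL_dev a b g f s xi : R :=
  let t := nth b (a :: s) in
  \sum_(i < size s) `|f (t i.+1) - f (t i) - (t i.+1 - t i) *: g (xi i)|.

Lemma HL_dev_ge0 a b g f s xi : 0 <= HL_dev a b g f s xi.
Proof. exact: sumr_ge0. Qed.

Lemma HL_dev_cat a c d g f s1 s2 xi1 xi2 : last a s1 = c ->
  HL_dev a d g f (s1 ++ s2) (cat_tags s1 xi1 xi2) =
  HL_dev a c g f s1 xi1 + HL_dev c d g f s2 xi2.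
Proof.
move=> l1; rewrite /HL_dev size_cat big_split_ord/=; congr (_ + _).
  apply: eq_bigr => i _.
  rewrite -[nth _ _ _]/(nth d (a :: s1 ++ s2) i.+1).
  by rewrite !(nth_cat_partitionL _ c) ?(ltnW (ltn_ord i))// /cat_tags ltn_ord.
apply: eq_bigr => i _.
rewrite -[nth _ _ _]/(nth d (a :: s1 ++ s2) (size s1 + i).+1) -addnS.
by rewrite !(nth_cat_partitionR _ _ _ l1) /cat_tags ltnNge leq_addr/= addKn.
Qed.

(** The increments of f telescope over a partition; this bounds the distance between
the increment of f and the Riemann sum of g. *)
Lemma HL_dev_ge a b g f s xi : itv_partition a b s ->
  `|f b - f a - \sum_(i < size s)
      (nth b (a :: s) i.+1 - nth b (a :: s) i) *: g (xi i)|
    <= HL_dev a b g f s xi.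
Proof.
move=> ps; pose t := nth b (a :: s).
have -> : f b - f a = \sum_(i < size s) (f (t i.+1) - f (t i)).
  rewrite -(big_mkord predT (fun i => f (t i.+1) - f (t i))) telescope_sumr//.
  by congr (f _ - _); rewrite /t (itv_partition_nth_size _ ps).
by rewrite -sumrB; exact: ler_norm_sum.
Qed.

(** A gauge delta that witnesses the definition of a primitive for one eps. Keeping
the gauge explicit matters: the gauge is shared by all subintervals. *)
Definition HL_control a b g f eps delta :=
  (forall t, a <= t <= b -> 0 < delta t) /\
  forall s xi, is_fine_tagged_partition a b delta s xi ->
    HL_dev a b g f s xi < eps.

Lemma HL_primitiveP a b g f : is_HL_primitive a b g f <->
  forall eps, 0 < eps -> exists delta, HL_control a b g f eps delta.
Proof.
by split=> H eps /H; [move=> [delta]|move=> [delta []]]; exists delta.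
Qed.

(** Cousin's lemma extends a fine partition of [c, d] to a fine partition of [a, b],
and the deviation of the larger partition contains that of the smaller one as a
partial sum of nonnegative terms. *)
Lemma saks_henstock a b c d g f eps delta : a <= c -> c <= d -> d <= b ->
  HL_control a b g f eps delta -> HL_control c d g f eps delta.
Proof.
move=> ac cd db [delta0 dev]; split=> [t /andP[ct td]|s xi p].
  by apply: delta0; rewrite (le_trans ac ct) (le_trans td db).
have [t /andP[at_ tc]|s1 [xi1 p1]] := @cousin _ delta _ _ ac.
  by apply: delta0; rewrite at_ (le_trans tc (le_trans cd db)).
have [t /andP[dt tb]|s2 [xi2 p2]] := @cousin _ delta _ _ db.
  by apply: delta0; rewrite tb (le_trans (le_trans ac cd) dt).
have l1 : last a s1 = c by case: p1 => -[_ /eqP].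
have l : last c s = d by case: p => -[_ /eqP].
apply: le_lt_trans (dev _ _ (fine_partition_cat p1 (fine_partition_cat p p2))).
rewrite (HL_dev_cat _ _ _ _ _ _ l1) (HL_dev_cat _ _ _ _ _ _ l).
have := HL_dev_ge0 a c g f s1 xi1; have := HL_dev_ge0 d b g f s2 xi2; lra.
Qed.

Lemma HL_primitive_sub a b c d g f : a <= c -> c <= d -> d <= b ->
  is_HL_primitive a b g f -> is_HL_primitive c d g f.
Proof.
move=> ac cd db /HL_primitiveP pf; apply/HL_primitiveP => eps /pf[delta].
by move=> /(saks_henstock ac cd db); exists delta.
Qed.

Lemma eq_of_dist_lt (x y : E) : (forall eps, 0 < eps -> `|x - y| < eps) -> x = y.
Proof.
move=> xy; apply/eqP; rewrite -subr_eq0 -normr_eq0; apply: contraT => xy0.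
by have := xy `|x - y|; rewrite ltxx; apply; rewrite lt_neqAle eq_sym xy0/=.
Qed.

(** On a partition that is fine for both gauges, both increments are close to one and
the same Riemann sum. *)
Lemma HL_primitive_incr_unique a b g f1 f2 : a <= b ->
  is_HL_primitive a b g f1 -> is_HL_primitive a b g f2 ->
  f1 b - f1 a = f2 b - f2 a.
Proof.
move=> ab /HL_primitiveP pf1 /HL_primitiveP pf2.
apply: eq_of_dist_lt => eps eps0.
have eps20 : 0 < eps / 2 by lra.
have [delta1 [delta10 dev1]] := pf1 _ eps20.
have [delta2 [delta20 dev2]] := pf2 _ eps20.
pose delta t := Num.min (delta1 t) (delta2 t).
have [t tab|s [xi [ps fs]]] := @cousin _ delta _ _ ab.
  by rewrite /delta lt_min delta10//= delta20.
have le_fine delta' : (forall t, delta t <= delta' t) ->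
    is_fine_tagged_partition a b delta' s xi.
  move=> le; split=> // i /fs[? sub]; split=> // u /sub/=.
  rewrite !in_itv/= => /andP[lu ur]; have := le (xi i).
  by move=> ?; apply/andP; split; lra.
have p1 : is_fine_tagged_partition a b delta1 s xi.
  by apply: le_fine => t; rewrite /delta ge_min lexx.
have p2 : is_fine_tagged_partition a b delta2 s xi.
  by apply: le_fine => t; rewrite /delta ge_min lexx orbT.
have := le_lt_trans (HL_dev_ge g f1 xi ps) (dev1 _ _ p1).
have := le_lt_trans (HL_dev_ge g f2 xi ps) (dev2 _ _ p2).
move=> /=; set S := \sum_(i < _) _ => d2 d1.
rewrite -[X in `|X|](subrKA S) [ltRHS]splitr.
rewrite (le_lt_trans (ler_normD _ _))// ltrD//.
by rewrite distrC.
Qed.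

(** The single interval [u, t] tagged by t is a fine partition of [u, t] when u is
close to t, and (t - u) g(t) tends to 0. *)
Lemma HL_primitive_left_continuous a b g f t : a <= b -> is_HL_primitive a b g f ->
  a <= t <= b -> forall eps, 0 < eps -> exists2 delta, 0 < delta &
  forall u, a <= u <= t -> t - delta < u -> `|f t - f u| < eps.
Proof.
move=> ab /HL_primitiveP pf /andP[at_ tb] eps eps0.
have [delta [delta0 dev]] : exists delta, HL_control a b g f (eps / 2) delta.
  by apply: pf; lra.
have dt0 : 0 < delta t by apply: delta0; rewrite at_.
have g1 : 0 < 1 + `|g t| by rewrite ltr_pwDl.
exists (Num.min (delta t) (eps / 2 / (1 + `|g t|))).
  by rewrite lt_min dt0/= divr_gt0//; lra.
move=> u /andP[au]; rewrite le_eqVlt => /predU1P[->|ut] tu.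
  by rewrite subrr normr0.
have [_ /(_ [:: t] (fun=> t))] := saks_henstock au (ltW ut) tb (conj delta0 dev).
rewrite /HL_dev big_ord1/= => devt.
have {}devt : `|f t - f u - (t - u) *: g t| < eps / 2.
  apply: devt; apply: fine_partition1 => //; [by rewrite (ltW ut) lexx| |by lra].
  by apply: le_lt_trans tu; rewrite lerD2l lerN2 ge_min lexx.
have tug : (t - u) * `|g t| < eps / 2.
  have : t - u < eps / 2 / (1 + `|g t|).
    by rewrite ltrBlDr -ltrBlDl (le_lt_trans _ tu)// lerD2l lerN2 ge_min lexx orbT.
  rewrite ltr_pdivlMr//; apply: le_lt_trans; apply: ler_wpM2l; lra.
rewrite -[f t - f u](subrK ((t - u) *: g t)).
rewrite (le_lt_trans (ler_normD _ _))// [ltRHS]splitr ltrD//.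
by rewrite normrZ gtr0_norm// subr_gt0.
Qed.

End Primitives.

(** * Maps with a derivative off a countable set *)

Section CountableExceptions.
Context {R : realType} {E : normedModType R}.
Implicit Types (a b c eps u v t : R) (delta : R -> R) (s : seq R) (xi : nat -> R).
Implicit Types f g : R -> E.

Lemma sum_half_pow n : \sum_(k < n) (2^-1 : R) ^+ k <= 2.
Proof.
have -> : \sum_(k < n) (2^-1 : R) ^+ k = 2 - 2 * 2^-1 ^+ n.
  elim: n => [|n IHn]; first by rewrite big_ord0 expr0; lra.
  by rewrite big_ord_recr/= IHn exprS; lra.
by rewrite lerBlDr lerDl mulr_ge0// exprn_ge0.
Qed.

Lemma sum_half_pow_inj (I : finType) (P : pred I) (h : I -> nat) :
  {in P &, injective h} -> \sum_(i | P i) (2^-1 : R) ^+ h i <= 2.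
Proof.
move=> injh; pose M := (\max_i h i).+1.
have hM i : (h i < M)%N by rewrite ltnS leq_bigmax.
pose h' i := Ordinal (hM i).
have injh' : {in P &, injective h'} by move=> i j Pi Pj [] /injh; exact.
apply: le_trans (sum_half_pow M).
under eq_bigr do rewrite -[h _]/(val (h' _)).
rewrite -(big_imset (fun k : 'I_M => (2^-1 : R) ^+ k) injh')/=.
rewrite big_mkcond/=; apply: ler_sum => k _.
by case: ifP => // _; rewrite exprn_ge0.
Qed.

(** Two intervals with a common tag are adjacent, so the indices of the intervals
with a given tag have different parities. *)
Lemma fine_tags_parity_inj a b delta s xi i j :
  is_fine_tagged_partition a b delta s xi -> (i < size s)%N -> (j < size s)%N ->
  xi i = xi j -> odd i = odd j -> i = j.
Proof.
move=> [[ps _] fs].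
wlog ij : i j / (i < j)%N => [wl|] il jl xij oij.
  by case: (ltngtP i j) => // ij; [exact: wl|apply/esym; exact: wl].
have ij2 : (i.+1 < j)%N.
  by rewrite ltn_neqAle ij andbT; apply: contra_eqN oij => /eqP <-/=; case: (odd i).
have [/andP[_ xit] _] := fs _ il; have [/andP[txj _] _] := fs _ jl.
have : nth b (a :: s) i.+1 < nth b (a :: s) j.
  by apply: (sorted_ltn_nth lt_trans) => //; rewrite inE/= ltnS// ltnW.
by rewrite ltNge (le_trans txj)// -xij.
Qed.

Lemma sum_tags_half_pow a b delta s xi (D : set R) (N : R -> nat) :
  {in D &, injective N} -> is_fine_tagged_partition a b delta s xi ->
  \sum_(i < size s) (if xi i \in D then (2^-1 : R) ^+ N (xi i) else 0) <= 4.
Proof.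
move=> injN p; rewrite -big_mkcond/= (bigID (fun i : 'I_ _ => odd i))/=.
rewrite (_ : 4 = 2 + 2); last by ring.
apply: lerD; apply: (sum_half_pow_inj (h := fun i : 'I_(size s) => N (xi i))).
all: move=> i j /andP[iD oi] /andP[jD oj] /(injN _ _ iD jD) xij.
all: apply/val_inj/(fine_tags_parity_inj p (ltn_ord i) (ltn_ord j) xij).
  by rewrite (oi : odd i = true) (oj : odd j = true).
by rewrite (negbTE (oi : ~~ odd i)) (negbTE (oj : ~~ odd j)).
Qed.

(** The exceptional points are numbered by N. At the point with number n the
gauge makes the deviation at most eps / 8 * 2^-n, so all exceptional tags together
contribute at most eps / 2; the other tags contribute at most e times the
length of the interval they tag, less than eps / 2 in total. *)
Lemma HL_primitive_of_derivative a b g f (D : set R) : a <= b -> countable D ->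
  (forall t, D t -> a <= t <= b -> forall eps, 0 < eps ->
    exists2 delta, 0 < delta & forall u, a <= u <= b -> `|u - t| < delta ->
      `|f u - f t| < eps) ->
  (forall t, ~ D t -> a <= t <= b -> forall eps, 0 < eps ->
    exists2 delta, 0 < delta & forall u v, a <= u -> u <= t -> t <= v -> v <= b ->
      v - u < delta -> `|f v - f u - (v - u) *: g t| <= eps * (v - u)) ->
  is_HL_primitive a b g f.
Proof.
move=> ab /countable_injP[N injN] contD derD; apply/HL_primitiveP => eps eps0.
pose e := eps / 4 / (b - a + 1).
have e0 : 0 < e by rewrite !divr_gt0//; lra.
pose w t := if t \in D then (2^-1 : R) ^+ N t else 0.
have [delta deltaP] : exists delta, forall t, a <= t <= b -> 0 < delta t /\
    forall u v, a <= u -> u <= t -> t <= v -> v <= b -> v - u < delta t ->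
    `|f v - f u - (v - u) *: g t| <= e * (v - u) + eps / 8 * w t.
  suff /choice[delta H] : forall t, exists d, a <= t <= b -> 0 < d /\
      forall u v, a <= u -> u <= t -> t <= v -> v <= b -> v - u < d ->
      `|f v - f u - (v - u) *: g t| <= e * (v - u) + eps / 8 * w t by exists delta.
  move=> t; have [tab|] := boolP (a <= t <= b); last by exists 0.
  have [Dt|nDt] := pselect (D t); last first.
    have [d d0 dP] := derD _ nDt tab _ e0; exists d => _; split=> // u v *.
    by rewrite /w memNset// mulr0 addr0; exact: dP.
  pose k := eps / 8 * w t.
  have k0 : 0 < k by rewrite /k /w mem_set// mulr_gt0//; lra.
  have k30 : 0 < k / 3 by lra.
  have [d d0 dP] := contD _ Dt tab _ k30.
  have g1 : 0 < 1 + `|g t| by rewrite ltr_pwDl.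
  exists (Num.min d (k / 3 / (1 + `|g t|))) => _; split.
    by rewrite lt_min d0/= divr_gt0.
  move=> u v au ut tv vb; rewrite lt_min => /andP[uvd uvk].
  have fv : `|f v - f t| < k / 3.
    apply: dP; first by rewrite vb andbT; lra.
    by rewrite ger0_norm; lra.
  have fu : `|f u - f t| < k / 3.
    apply: dP; first by rewrite au/=; lra.
    by rewrite ler0_norm; lra.
  have gk : `|(v - u) *: g t| <= k / 3.
    rewrite normrZ ger0_norm; last by lra.
    move: uvk; rewrite ltr_pdivlMr// => /ltW; apply: le_trans.
    by apply: ler_wpM2l; lra.
  have e1 : 0 <= e * (v - u) by rewrite mulr_ge0//; lra.
  have -> : f v - f u - (v - u) *: g t = (f v - f t) - (f u - f t) - (v - u) *: g t.
    by rewrite opprB addrA subrK.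
  have := ler_normB (f v - f t - (f u - f t)) ((v - u) *: g t).
  have := ler_normB (f v - f t) (f u - f t).
  by rewrite -/k; lra.
(* An interval inside the ball of radius delta t / 2 has length below delta t. *)
pose delta' t := delta t / 2.
exists delta'; split=> [t /deltaP[d0 _]|s xi p]; first by rewrite /delta'; lra.
have [ps fs] := p; set T := nth b (a :: s).
have -> : eps = eps / 2 + eps / 2 by lra.
apply: (@le_lt_trans _ _
  (\sum_(i < size s) (e * (T i.+1 - T i) + eps / 8 * w (xi i)))).
  apply: ler_sum => i _; have [/andP[tx xt] sub] := fs _ (ltn_ord i).
  have aT : a <= T i by apply: itv_partition_nth_ge => //; rewrite ltnS ltnW.
  have Tb : T i.+1 <= b by apply: itv_partition_nth_le => //; rewrite ltnS.
  have xab : a <= xi i <= b by rewrite (le_trans aT tx) (le_trans xt Tb).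
  have [d0 dP] := deltaP _ xab; apply: (dP (T i) (T i.+1)) => //.
  have TT : T i <= T i.+1 by exact: le_trans tx xt.
  have := sub (T i); have := sub (T i.+1); rewrite /= !in_itv/= !lexx TT.
  by rewrite /delta' => /(_ isT)/andP[_ ?] /(_ isT)/andP[? _]; lra.
rewrite big_split/= -!mulr_sumr.
have -> : \sum_(i < size s) (T i.+1 - T i) = b - a.
  rewrite -(big_mkord predT (fun i => T i.+1 - T i)) telescope_sumr//.
  by rewrite /T (itv_partition_nth_size _ ps).
have := sum_tags_half_pow injN p; rewrite -/(w _) => w4.
have : eps / 8 * (\sum_(i < size s) w (xi i)) <= eps / 8 * 4.
  by apply: ler_wpM2l => //; lra.
have : e * (b - a) < eps / 2.
  rewrite /e mulrAC ltr_pdivrMr; last by lra.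
  have : 0 <= eps * (b - a) by rewrite mulr_ge0//; lra.
  lra.
lra.
Qed.

End CountableExceptions.

(** * Affine pieces *)

Section AffinePieces.
Context {R : realType} {E : normedModType R}.
Implicit Types (c d eps : R) (w p y : E) (g : R -> E).

Lemma scaler_small w eps : 0 < eps ->
  exists2 delta, 0 < delta & forall h : R, `|h| < delta -> `|h *: w| < eps.
Proof.
move=> eps0; have w1 : 0 < 1 + `|w| by rewrite ltr_pwDl.
exists (eps / (1 + `|w|)); first by rewrite divr_gt0.
move=> h; rewrite ltr_pdivlMr// normrZ; apply: le_lt_trans.
by apply: ler_wpM2l => //; rewrite lerDr.
Qed.

(** Balls are convex: a point between p and p + L w is as close to y as the two ends. *)
Lemma affine_dist_lt p w y (h L : R) eps : 0 < L -> 0 <= h <= L ->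
  `|p - y| < eps -> `|p + L *: w - y| < eps -> `|p + h *: w - y| < eps.
Proof.
move=> L0 /andP[h0 hL]; rewrite ![_ + _ *: w - y]addrAC.
move: (p - y) => P py pwy.
pose theta := h / L.
have theta0 : 0 <= theta by rewrite divr_ge0// ltW.
have theta1 : theta <= 1 by rewrite ler_pdivrMr// mul1r.
have thetaL : theta * L = h by rewrite /theta -mulrA mulVf ?gt_eqF// mulr1.
clearbody theta.
have -> : P + h *: w = (1 - theta) *: (P) + theta *: (P + L *: w).
  rewrite scalerBl scale1r scalerDr scalerA thetaL.
  by rewrite addrA subrK.
rewrite (le_lt_trans (ler_normD _ _))// !normrZ (ger0_norm theta0).
rewrite (ger0_norm (_ : 0 <= 1 - theta)); last by rewrite subr_ge0.
have : Num.max `|P| `|P + L *: w| < eps by rewrite gt_max py.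
apply: le_lt_trans; set M := Num.max _ _.
have -> : M = (1 - theta) * M + theta * M by ring.
by rewrite lerD// ler_wpM2l ?subr_ge0// le_max lexx ?orbT.
Qed.

(** The value g(d) is free, since d can be put into the exceptional set. This is the
situation on [alpha, S(alpha)], where g may jump at S(alpha). *)
Lemma HL_primitive_constant c d g w : c <= d ->
  (forall t, c <= t < d -> g t = w) ->
  is_HL_primitive c d g (fun t => (t - c) *: w).
Proof.
move=> cd gw; apply: (HL_primitive_of_derivative cd (countable1 d)).
  move=> t _ _ eps /(scaler_small w)[delta delta0 dP]; exists delta => // u _.
  by rewrite -scalerBl opprB addrA subrK; exact: dP.
move=> t td /andP[ct tled] eps eps0; exists 1 => // u v cu ut tv vd _.
rewrite gw; last by rewrite ct lt_neqAle tled andbT; apply/eqP.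
rewrite -!scalerBl (_ : _ - _ - _ = 0); last by ring.
by rewrite scale0r normr0 mulr_ge0 ?(ltW eps0)// subr_ge0 (le_trans ut).
Qed.

End AffinePieces.

(** * Partial sums along a well-ordered set *)

Section PartialSums.
Context {R : realType} {E : normedModType R}.
Implicit Types (G : set (\bar R)) (x sigma : \bar R -> E).
Local Open Scope ereal_scope.

(** Limits along the elements below gamma are unique: those elements form a chain, so
two thresholds admit a common element beyond both. *)
Lemma partial_sums_limit_unique G x sigma1 sigma2 m gamma :
  is_partial_sums G x sigma1 -> is_partial_sums G x sigma2 ->
  (G `|` [set ereal_sup G]) gamma -> least G m -> m < gamma ->
  ~ (exists beta, is_succ G beta gamma) ->
  (forall beta, G beta -> beta < gamma -> sigma1 beta = sigma2 beta) ->
  sigma1 gamma = sigma2 gamma.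
Proof.
move=> [_ _ lim1] [_ _ lim2] Ggamma Gm mgamma nsucc eq12.
apply: eq_of_dist_lt => eps eps0.
have eps20 : (0 < eps / 2)%R by lra.
have [b1 [Gb1 b1g] b1P] := lim1 _ _ Ggamma Gm mgamma nsucc _ eps20.
have [b2 [Gb2 b2g] b2P] := lim2 _ _ Ggamma Gm mgamma nsucc _ eps20.
have [beta [Gb b1b b2b bg]] :
    exists beta, [/\ G beta, b1 <= beta, b2 <= beta & beta < gamma].
  by case: (leP b1 b2) => b12; [exists b2|exists b1; rewrite (ltW b12)].
have := b1P _ Gb b1b bg; have := b2P _ Gb b2b bg; rewrite (eq12 _ Gb bg) => d2 d1.
rewrite -(subrKA (sigma2 beta)) (le_lt_trans (ler_normD _ _))//.
by rewrite [ltRHS]splitr ltrD// distrC.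
Qed.

(** Transfinite induction: a least element at which the two families differ is neither
the minimum nor a successor nor a limit. The supremum, which may lie outside G, is
treated as one more limit. *)
Lemma partial_sums_unique G x sigma1 sigma2 : well_ordered G -> G !=set0 ->
  is_partial_sums G x sigma1 -> is_partial_sums G x sigma2 ->
  {in G `|` [set ereal_sup G], sigma1 =1 sigma2}.
Proof.
move=> [_ wo] G0 ps1 ps2.
have [m Gm] := wo G (fun _ => id) G0.
have eqG gamma : G gamma -> sigma1 gamma = sigma2 gamma.
  pose B := [set beta | G beta /\ sigma1 beta <> sigma2 beta].
  move=> Ggamma; apply: contrapT => neq.
  have [||c [[Gc neqc] minc]] := wo B; [by move=> ? []|by exists gamma|].
  have below_c beta : G beta -> beta < c -> sigma1 beta = sigma2 beta.
    by move=> Gb; rewrite ltNge => /negP bc; apply: contrapT => ?; exact/bc/minc.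
  apply: neqc; have [<-|mc] := eqVneq m c.
    by case: ps1 ps2 => [s10 _ _] [s20 _ _]; rewrite s10// s20.
  have [[beta bc]|nsucc] := pselect (exists beta, is_succ G beta c).
    case: (ps1) (ps2) => [_ s1S _] [_ s2S _]; rewrite (s1S _ _ bc) (s2S _ _ bc).
    by case: bc => Gb [[_ bc] _]; rewrite (below_c _ Gb bc).
  apply: (partial_sums_limit_unique ps1 ps2 _ Gm _ nsucc below_c); first by left.
  by rewrite lt_neqAle mc Gm.2.
move=> gamma /set_mem[/eqG//|/= ->].
have [/eqG//|nGs] := pselect (G (ereal_sup G)).
apply: (partial_sums_limit_unique ps1 ps2 _ Gm) => //; first by right.
- rewrite lt_neqAle ereal_sup_ubound ?andbT; last by case: Gm.
  by apply: contra_notN nGs => /eqP <-; case: Gm.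
- by case=> beta [_ [[]]].
- by move=> beta /eqG.
Qed.

End PartialSums.

(** * Closed well-ordered subsets of an interval *)

Section ClosedWellOrdered.
Context {R : realType} (a b : R) (ab : a < b) (Lambda : set (\bar R))
  (Lambda_wo : well_ordered Lambda)
  (Lambda_sub : Lambda `<=` `[a%:E, b%:E]%classic)
  (Lambda_min : least Lambda a%:E)
  (Lambda_max : greatest Lambda b%:E)
  (Lambda_cover : `[a%:E, b%:E[%classic =
     \bigcup_(alpha in below Lambda b%:E) `[alpha, succ Lambda alpha[%classic).
Local Notation G := (below Lambda b%:E).
Local Notation s := (ereal_sup (below Lambda b%:E)).

Lemma Lambda_real beta : Lambda beta ->
  exists2 r : R, beta = r%:E & a <= r <= b.
Proof.
move=> /Lambda_sub/=; rewrite in_itv/=; case: beta => [r| |].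
- by rewrite !lee_fin; exists r.
- by rewrite andbC leNgt ltry.
- by rewrite leNgt ltNyr.
Qed.

Lemma is_succ_succ beta gamma : is_succ Lambda beta gamma ->
  G beta /\ succ Lambda beta = gamma.
Proof.
move=> bg; have [Lb [[Lg bltg] ming]] := bg; split.
  by split=> //; apply: (lt_le_trans bltg); exact: Lambda_max.2.
apply: xget_unique => // y [_ [[Ly by_] miny]].
by apply/le_anti; rewrite ming//= miny.
Qed.

Lemma succ_real r : G r%:E -> exists q : R, [/\ succ Lambda r%:E = q%:E,
  Lambda q%:E, r < q, q <= b & forall p, Lambda p -> (r%:E < p)%E -> (q%:E <= p)%E].
Proof.
move=> [Lr rb]; have [_ wo] := Lambda_wo.
have [||y miny] := wo (above Lambda r%:E); first by move=> ? [].
  by exists b%:E; split=> //; case: Lambda_max.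
have [_ ->] := @is_succ_succ r%:E y (conj Lr miny).
have [[Ly ry] minyP] := miny.
have [q qE /andP[aq qb]] := Lambda_real Ly; exists q; rewrite -qE; split=> //.
  by move: ry; rewrite qE lte_fin.
by move=> p Lp rp; exact: minyP.
Qed.

Lemma succ_cover t : a <= t < b -> exists r q : R,
  [/\ G r%:E, succ Lambda r%:E = q%:E, r <= t & t < q].
Proof.
move=> tab; have : `[a%:E, b%:E[%classic t%:E by rewrite /= in_itv/= lee_fin lte_fin.
rewrite Lambda_cover => -[alpha Ga].
have [r rE _] := Lambda_real Ga.1; rewrite rE in Ga *.
have [q [qE _ _ _ _]] := succ_real Ga; rewrite qE /= in_itv/= lee_fin lte_fin.
by move=> /andP[rt tq]; exists r, q.
Qed.

(** If t lies in [r, S(r)) and t < c, then S(r) <= c, and S(r) = c would make c a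
successor; so S(r) is the element sought. *)
Lemma limit_approx c t : Lambda c%:E -> ~ (exists beta, is_succ Lambda beta c%:E) ->
  a <= t < c -> exists2 r, Lambda r%:E & t < r < c.
Proof.
move=> Lc nsucc /andP[at_ tc].
have cb : c <= b by have := Lambda_max.2 _ Lc; rewrite lee_fin.
have [|r [q [Gr qE rt tq]]] := @succ_cover t; first by rewrite at_ (lt_le_trans tc).
have [q' []] := succ_real Gr; rewrite qE => -[<-] Lq rq qb minq.
exists q; rewrite ?tq//= lt_neqAle -lee_fin minq//; last first.
  by rewrite lte_fin (le_lt_trans rt).
rewrite andbT; apply/eqP => qc; apply: nsucc; exists r%:E; rewrite -qc.
by split; [case: Gr|split=> [|p [Lp rp]]; [split|exact: minq]].
Qed.

Lemma well_ordered_below : well_ordered G.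
Proof.
have [LN wo] := Lambda_wo; split; first by case.
by move=> B BG; apply: wo => x /BG[].
Qed.

Lemma least_below : least G a%:E.
Proof.
split; first by split; [case: Lambda_min|rewrite lte_fin].
by move=> y [Ly _]; exact: Lambda_min.2.
Qed.

Lemma least_of_below m : least G m -> m = a%:E.
Proof.
move=> Gm; apply/le_anti.
by rewrite Gm.2 ?least_below.2//; [case: Gm|case: least_below].
Qed.

Lemma least_Lambda m : least Lambda m -> m = a%:E.
Proof.
move=> Lm; apply/le_anti.
by rewrite Lm.2 ?Lambda_min.2//; [case: Lm|case: Lambda_min].
Qed.

Lemma sup_Lambda : ereal_sup Lambda = b%:E.
Proof.
apply/eqP; rewrite eq_le ereal_sup_ubound ?andbT; last by case: Lambda_max.
by apply: ge_ereal_sup; case: Lambda_max.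
Qed.

Lemma is_succ_below beta gamma : G gamma ->
  is_succ Lambda beta gamma <-> is_succ G beta gamma.
Proof.
move=> Gg; split=> [bg|[Gb [[_ bg] ming]]].
  have [Gb _] := is_succ_succ bg; have [_ [[Lg bltg] ming]] := bg.
  by split=> //; split=> // y [[Ly _] byl]; apply: ming.
split; first by case: Gb.
split; first by split=> //; case: Gg.
move=> y [Ly byl]; have [yb|yb] := ltP y b%:E; first by apply: ming.
exact: le_trans (ltW Gg.2) yb.
Qed.

(** Suppose that the supremum s is not attained. If s < b, then s would lie in some
interval [r, S(r)) of the cover, and no element of Lambda lies strictly between r
and S(r), against s being a supremum that is not attained. *)
Lemma sup_below : (G s /\ is_succ Lambda s b%:E) \/
  [/\ ~ G s, s = b%:E & ~ exists beta, is_succ Lambda beta b%:E].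
Proof.
have [Gs|nGs] := pselect (G s); [left|right].
  split=> //; split; first by case: Gs.
  split; first by split; [case: Lambda_max|case: Gs].
  move=> y [Ly sy]; rewrite leNgt; apply/negP => yb.
  by move: sy; rewrite ltNge ereal_sup_ubound.
have sb : (s <= b%:E)%E by apply: ge_ereal_sup => y [_ /ltW].
have as_ : (a%:E <= s)%E by apply: ereal_sup_ubound; case: least_below.
have sE : s = b%:E.
  apply/eqP; rewrite eq_le sb/= leNgt; apply/negP => sltb.
  have sfin : s \is a fin_num.
    by rewrite fin_numElt (lt_le_trans (ltNyr a) as_) (le_lt_trans sb (ltry b)).
  have [|r [q [Gr qE rs sq]]] := @succ_cover (fine s).
    by rewrite -lee_fin -lte_fin fineK// as_.
  rewrite -lte_fin fineK// in sq; rewrite -lee_fin fineK// in rs.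
  have [p Gp rp] : exists2 p, G p & (r%:E < p)%E.
    apply: ereal_sup_gt; rewrite lt_neqAle rs andbT.
    by apply: contra_notN nGs => /eqP <-.
  have [q' []] := succ_real Gr; rewrite qE => -[<-] _ _ _ /(_ _ Gp.1 rp) qp.
  by have := lt_le_trans sq qp; rewrite ltNge ereal_sup_ubound.
split=> //; case=> beta bb; have [Gb _] := is_succ_succ bb.
have [_ [[_ bltb] minb]] := bb.
have : (beta < s)%E by rewrite sE.
move=> /ereal_sup_gt[y [Ly yb] by_].
by have := minb y (conj Ly by_); rewrite leNgt yb.
Qed.

Section Sums.
Context {E : normedModType R}.
Implicit Types x sigma tau : \bar R -> E.

(** If b is the successor of s, the last term x(s) is added in the step from s to b;
otherwise b = s is a limit. In both cases tau(b) is the sum of the family. *)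
Lemma partial_sums_below x tau : is_partial_sums Lambda x tau ->
  is_partial_sums G x tau /\
  tau b%:E = if s \in G then tau s + x s else tau s.
Proof.
move=> [tau0 tauS tauL]; split; last first.
  have [[Gs /tauS ->]|[nGs sE _]] := sup_below; first by rewrite mem_set.
  by rewrite memNset// sE.
split.
- by move=> m /least_of_below ->; exact: tau0.
- move=> beta gamma bg; apply: tauS; apply/is_succ_below => //.
  by case: bg => _ [[]].
move=> gamma m Ggamma /least_of_below -> mg nsucc eps eps0.
have [Lg nsuccL] : Lambda gamma /\ ~ exists beta, is_succ Lambda beta gamma.
  have [Gg|] := pselect (G gamma).
    split; first by case: Gg.
    by case=> beta bg; apply: nsucc; exists beta; apply/is_succ_below.
  case: Ggamma => //= -> nGs; have [[]//|[_ -> ns]] := sup_below.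
  by split=> //; case: Lambda_max.
have gb : (gamma <= b%:E)%E by exact: Lambda_max.2.
have [beta [Lb bg] bP] := tauL gamma a%:E (or_introl Lg) Lambda_min mg nsuccL eps eps0.
exists beta; first by split=> //; split=> //; exact: lt_le_trans gb.
by move=> c [Lc _]; exact: bP.
Qed.

(** At b the recursion leaves a single choice: one more term if b is a successor, and
the value sigma(b) already present otherwise. *)
Lemma partial_sums_extend x sigma : is_partial_sums G x sigma ->
  exists tau, is_partial_sums Lambda x tau.
Proof.
move=> [sigma0 sigmaS sigmaL].
pose W := if s \in G then sigma s + x s else sigma s.
pose tau c := if (c < b%:E)%E then sigma c else W.
have tauG c : G c -> tau c = sigma c by move=> [_ cb]; rewrite /tau cb.
exists tau; split.
- move=> m /least_Lambda ->; rewrite tauG; first exact/sigma0/least_below.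
  by case: least_below.
- move=> beta gamma bg; have [Gb bS] := is_succ_succ bg; rewrite (tauG _ Gb).
  have [_ [[Lg bltg] ming]] := bg.
  have gb : (gamma <= b%:E)%E by exact: Lambda_max.2.
  rewrite /tau; case: ltP => gb'.
    by apply: sigmaS; apply/is_succ_below.
  have gbE : gamma = b%:E by apply/le_anti; rewrite gb gb'.
  rewrite gbE in bg bS; have [[Gs sb]|[_ _ ns]] := sup_below; last first.
    by case: ns; exists beta.
  rewrite /W mem_set//; suff -> : s = beta by [].
  apply/le_anti; rewrite ereal_sup_ubound// andbT.
  have [_ [_ minb]] := bg.
  rewrite leNgt; apply/negP => bs; have := minb s (conj Gs.1 bs).
  by rewrite leNgt Gs.2.
move=> gamma m Lg /least_Lambda -> mg nsucc eps eps0.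
have {}Lg : Lambda gamma.
  by case: Lg => //= ->; rewrite sup_Lambda; case: Lambda_max.
have gb : (gamma <= b%:E)%E by exact: Lambda_max.2.
have [Gg nsuccG tg] : [/\ (G `|` [set s]) gamma,
    ~ (exists beta, is_succ G beta gamma) & tau gamma = sigma gamma].
  rewrite /tau; case: ltP => gb'.
    have Gg : G gamma by [].
    split=> //; first by left.
    by case=> beta bg; apply: nsucc; exists beta; apply/is_succ_below.
  have gbE : gamma = b%:E by apply/le_anti; rewrite gb gb'.
  have [[Gs sb]|[nGs sE ns]] := sup_below.
    by case: nsucc; exists s; rewrite gbE.
  have -> : gamma = s by rewrite gbE.
  split; [by right| |by rewrite /W memNset].
  by case=> beta [_ [[]]].
have [beta [[Lb bltb] bg] bP] := sigmaL _ _ Gg least_below mg nsuccG _ eps0.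
exists beta => //; move=> c Lc bc cg; have cb := lt_le_trans cg gb.
by rewrite tg tauG//; exact: bP.
Qed.

Lemma wo_summable_below x : wo_summable G x <->
  exists tau, is_partial_sums Lambda x tau.
Proof.
split=> [[sigma ps _]|[tau /partial_sums_below[ps _]]].
  exact: partial_sums_extend ps.
exists tau => // sigma ps'; apply: partial_sums_unique ps' ps.
  exact: well_ordered_below.
by exists a%:E; case: least_below.
Qed.

Lemma wo_sum_below x tau : is_partial_sums Lambda x tau ->
  wo_sum G x = tau b%:E.
Proof.
move=> /partial_sums_below[ps ->]; rewrite /wo_sum.
suff -> : partial_sum G x s = tau s by [].
apply: (partial_sums_unique (x := x) well_ordered_below) => //.
- by exists a%:E; case: least_below.
- by apply: xgetI ps.
- by apply: mem_set; right.
Qed.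

End Sums.

(** * Step functions and their partial sums *)

Section StepFunction.
Context {E : normedModType R} (z : \bar R -> E) (g : R -> E)
  (gE : forall alpha t, below Lambda b%:E alpha ->
     (alpha <= t%:E)%E -> (t%:E < succ Lambda alpha)%E -> g t = z alpha).
Let x := fun alpha : \bar R => (fine (succ Lambda alpha) - fine alpha) *: z alpha.

Lemma partial_sums_of_primitive f : is_HL_primitive a b g f ->
  is_partial_sums Lambda x (fun gamma => f (fine gamma) - f a).
Proof.
move=> pf; split.
- by move=> m /least_Lambda ->; rewrite /= subrr.
- move=> beta gamma bg; have [Gb bS] := is_succ_succ bg.
  have [r rE /andP[ar rb]] := Lambda_real Gb.1; rewrite rE in Gb bS *.
  have [q [qE Lq rq qb _]] := succ_real Gb.
  rewrite /x bS -bS qE/= [RHS]addrC -[LHS](subrKA (f r)).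
  congr (_ + _).
  have grz t : r <= t < q -> g t = z r%:E.
    by move=> /andP[rt tq]; apply: gE; rewrite ?qE ?lee_fin ?lte_fin.
  have := HL_primitive_sub ar (ltW rq) qb pf.
  move/(HL_primitive_incr_unique (ltW rq))/(_ (HL_primitive_constant (ltW rq) grz)).
  by rewrite subrr scale0r subr0.
move=> gamma m Lg /least_Lambda -> mg nsucc eps eps0.
have {}Lg : Lambda gamma.
  by case: Lg => //= ->; rewrite sup_Lambda; case: Lambda_max.
have [c cE acb] := Lambda_real Lg; rewrite cE in Lg mg nsucc *.
have [delta delta0 dP] := HL_primitive_left_continuous (ltW ab) pf acb eps0.
rewrite lte_fin in mg.
have [|r Lr /andP[tr rc]] := limit_approx (t := Num.max a (c - delta)) Lg nsucc.
  by rewrite le_max lexx gt_max mg/=; lra.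
exists r%:E; first by split.
move=> beta Lb; have [u uE /andP[au ub]] := Lambda_real Lb.
rewrite uE lee_fin lte_fin => ru uc /=.
rewrite distrC opprB addrA subrK; apply: dP; first by rewrite au ltW.
by move: tr; rewrite gt_max => /andP[_ ?]; lra.
Qed.

(** Each interval (t, S(t)) contains a rational number, and these intervals are
disjoint; the number 0 is reserved for b, which has no successor. *)
Lemma countable_Lambda : countable [set t : R | Lambda t%:E].
Proof.
have /choice[k kP] : forall t : R, exists k : rat, G t%:E ->
    t < ratr k /\ ((ratr k)%:E < succ Lambda t%:E)%E.
  move=> t; have [Gt|] := pselect (G t%:E); last by exists 0.
  have [q [-> _ tq _ _]] := succ_real Gt.
  have [k] := rat_in_itvoo tq; rewrite in_itv/= => /andP[tk kq].
  by exists k => _; rewrite lte_fin.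
apply/countable_injP; exists (fun t => if t < b then (pickle (k t)).+1 else 0%N).
have tb t : Lambda t%:E -> t <= b by move=> /Lambda_max.2; rewrite lee_fin.
have lt_k t u : Lambda t%:E -> Lambda u%:E -> t < b -> u < b -> k t = k u -> u <= t.
  move=> Lt Lu tb' ub' ktu; rewrite leNgt; apply/negP => tu.
  have Gt : G t%:E by split; rewrite ?lte_fin.
  have [_] := kP _ Gt; have [q [-> _ _ _ /(_ u%:E Lu)]] := succ_real Gt.
  rewrite !(lte_fin, lee_fin) ktu => /(_ tu) qu kq.
  have [|uk _] := kP u; first by split; rewrite ?lte_fin.
  by have := lt_le_trans kq qu; rewrite ltNge ltW.
move=> t u; rewrite !inE/= => Lt Lu.
case: ltP => tb'; case: ltP => // ub'; last first.
  by move=> _; apply/le_anti; rewrite (le_trans (tb _ Lt) ub') (le_trans (tb _ Lu) tb').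
by case=> /(pcan_inj pickleK) ktu; apply/le_anti; rewrite !lt_k.
Qed.

(** The primitive f interpolates tau affinely on each [r, S(r)]. The formula extends
to the right end S(r) by the recursion for tau, hence f is affine on the closed
piece, which settles one-sided continuity at all points of Lambda but limits. *)
Lemma primitive_of_partial_sums tau : is_partial_sums Lambda x tau ->
  exists f, is_HL_primitive a b g f.
Proof.
move=> [tau0 tauS tauL].
have [L_b ub_b] := Lambda_max.
pose idx t := xget 0 [set r : R | [/\ G r%:E, r <= t & (t%:E < succ Lambda r%:E)%E]].
have idxE r q t : G r%:E -> succ Lambda r%:E = q%:E -> r <= t < q -> idx t = r.
  move=> Gr qE /andP[rt tq]; apply: xget_unique; first by split; rewrite ?qE ?lte_fin.
  move=> r' [Gr' r't tr'].
  have [q' [q'E Lq' _ _ minq']] := succ_real Gr'.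
  have [q0 []] := succ_real Gr; rewrite qE => -[<-] Lq _ _ minq.
  rewrite q'E lte_fin in tr'; case: (ltgtP r' r) => // rr.
  - have := minq' r%:E Gr.1; rewrite lte_fin rr lee_fin => /(_ isT); lra.
  - have := minq r'%:E Gr'.1; rewrite lte_fin rr lee_fin => /(_ isT); lra.
(* idx t is the left end of the piece that contains t. *)
pose f t := if t < b then tau (idx t)%:E + (t - idx t) *: z (idx t)%:E else tau b%:E.
have fL r : Lambda r%:E -> f r = tau r%:E.
  move=> Lr; rewrite /f; case: ltP => [rb|br]; last first.
    by congr (tau _%:E); apply/le_anti; rewrite br -lee_fin ub_b.
  have Gr : G r%:E by split; rewrite ?lte_fin.
  have [q [qE _ rq _ _]] := succ_real Gr.
  by rewrite (idxE _ _ _ Gr qE) ?lexx// subrr scale0r addr0.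
have fpiece r q t : G r%:E -> succ Lambda r%:E = q%:E -> r <= t <= q ->
    f t = tau r%:E + (t - r) *: z r%:E.
  move=> Gr qE /andP[rt]; have [q0 []] := succ_real Gr.
  rewrite qE => -[<-] Lq rq qb minq; rewrite le_eqVlt => /predU1P[->|tq].
    rewrite fL// (tauS r%:E) ?/x ?qE//; split; first by case: Gr.
    by split=> [|p [Lp rp]]; [split; rewrite ?lte_fin|exact: minq].
  by rewrite /f (lt_le_trans tq qb) (idxE _ _ _ Gr qE)// rt.
have fpieceB r q t u : G r%:E -> succ Lambda r%:E = q%:E ->
    r <= t <= q -> r <= u <= q -> f u - f t = (u - t) *: z r%:E.
  move=> Gr qE /(fpiece _ _ _ Gr qE) -> /(fpiece _ _ _ Gr qE) ->.
  by rewrite opprD addrACA subrr add0r -scalerBl opprB addrA subrK.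
exists f; apply: (HL_primitive_of_derivative (ltW ab) countable_Lambda); last first.
  move=> t nLt /andP[at_ tb] eps eps0.
  have {}tb : t < b.
    by rewrite lt_neqAle tb andbT; apply: contra_notN nLt => /eqP ->.
  have [|r [q [Gr qE rt tq]]] := @succ_cover t; first by rewrite at_.
  have {}rt : r < t.
    by rewrite lt_neqAle rt andbT; apply: contra_notN nLt => /eqP <-; case: Gr.
  exists (Num.min (t - r) (q - t)); first by rewrite lt_min !subr_gt0 rt.
  move=> u v au ut tv vb; rewrite lt_min => /andP[uvr uvq].
  rewrite (gE (alpha := r%:E)) ?lee_fin ?(ltW rt)// ?qE//.
  rewrite (fpieceB r q)//; last 2 first.
  - by apply/andP; split; lra.
  - by apply/andP; split; lra.
  by rewrite subrr normr0 mulr_ge0 ?(ltW eps0)//; lra.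
move=> t Lt /andP[at_ tb] eps eps0.
suff [[d1 d10 d1P] [d2 d20 d2P]] :
    (exists2 d, 0 < d & forall u, t <= u -> u <= b -> u < t + d ->
       `|f u - f t| < eps) /\
    (exists2 d, 0 < d & forall u, a <= u -> u <= t -> t - d < u ->
       `|f u - f t| < eps).
  exists (Num.min d1 d2); first by rewrite lt_min d10.
  move=> u /andP[au ub]; rewrite lt_min !ltr_norml => /andP[/andP[_ u1] /andP[u2 _]].
  by case: (leP t u) => tu; [apply: d1P|apply: d2P] => //; lra.
split.
  have [bt|{}tb] := leP b t.
    exists 1 => // u tu ub _; have -> : u = t by lra.
    by rewrite subrr normr0.
  have Gt : G t%:E by split; rewrite ?lte_fin.
  have [q [qE _ tq _ _]] := succ_real Gt.
  have [d d0 dP] := scaler_small (z t%:E) eps0.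
  exists (Num.min d (q - t)); first by rewrite lt_min d0 subr_gt0.
  move=> u tu ub; rewrite -ltrBlDl lt_min => /andP[ud uq].
  rewrite (fpieceB t q) ?lexx ?tu ?(ltW tq)//; last by lra.
  by apply: dP; rewrite ger0_norm// subr_ge0.
have [ta|{}at_] := leP t a.
  exists 1 => // u au ut _; have -> : u = t by lra.
  by rewrite subrr normr0.
have [[beta bt]|nsucc] := pselect (exists beta, is_succ Lambda beta t%:E).
  have [Gb bS] := is_succ_succ bt.
  have [r rE _] := Lambda_real Gb.1; rewrite rE in Gb bS.
  have [q [qE _ rq _ _]] := succ_real Gb; move: qE; rewrite bS => -[tq].
  rewrite -tq in rq.
  have [d d0 dP] := scaler_small (z r%:E) eps0.
  exists (Num.min d (t - r)); first by rewrite lt_min d0 subr_gt0.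
  move=> u au ut; rewrite ltrBlDr -ltrBlDl lt_min => /andP[ud ur].
  rewrite (fpieceB r t) ?lexx ?ut ?(ltW rq)// ?andbT; last by lra.
  by apply: dP; rewrite distrC ger0_norm// subr_ge0.
(* At a limit element, u lies on the piece from r to q and c <= r < q < t. *)
have at_E : (a%:E < t%:E)%E by rewrite lte_fin.
have [beta [Lbeta bt] bP] :=
  tauL t%:E a%:E (or_introl Lt) Lambda_min at_E nsucc eps eps0.
have [c cE _] := Lambda_real Lbeta; rewrite cE lte_fin in Lbeta bt bP.
exists (t - c); first by rewrite subr_gt0.
move=> u au; rewrite le_eqVlt => /predU1P[->|ut cu]; first by rewrite subrr normr0.
have [|r [q [Gr qE ru uq]]] := @succ_cover u; first by rewrite au (lt_le_trans ut).
have [q0 []] := succ_real Gr; rewrite qE => -[<-] Lq rq qb minq.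
have cr : c <= r.
  rewrite leNgt; apply/negP => rc; have := minq _ Lbeta.
  by rewrite lte_fin lee_fin rc => /(_ isT); lra.
have qt : q < t.
  rewrite lt_neqAle -lee_fin minq ?lte_fin ?(le_lt_trans ru)// andbT.
  apply/eqP => qt; apply: nsucc; exists r%:E; rewrite -qt.
  by split; [case: Gr|split=> [|p [Lp rp]]; [split; rewrite ?lte_fin|exact: minq]].
rewrite (fpiece _ _ _ Gr qE) ?ru ?(ltW uq)// fL//.
have qr0 : 0 < q - r by lra.
have uqr : 0 <= u - r <= q - r by apply/andP; split; lra.
apply: (affine_dist_lt qr0 uqr).
  by apply: bP; rewrite ?lee_fin ?lte_fin ?(lt_trans rq)//; case: Gr.
rewrite -(fpiece _ _ _ Gr qE) ?lexx ?(ltW rq)// fL//.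
by apply: bP; rewrite // ?lee_fin ?lte_fin// (le_trans cr (ltW rq)).
Qed.

End StepFunction.
End ClosedWellOrdered.

(** * The equivalence *)

Theorem proposition3p1 (R : realType) (E : completeNormedModType R) (a b : R)
    (ab : a < b) (Lambda : set (\bar R))
    (Lambda_wo : well_ordered Lambda)
    (Lambda_sub : Lambda `<=` `[a%:E, b%:E]%classic)
    (Lambda_min : least Lambda a%:E)
    (Lambda_max : greatest Lambda b%:E)
    (Lambda_cover : `[a%:E, b%:E[%classic =
       \bigcup_(alpha in below Lambda b%:E) `[alpha, succ Lambda alpha[%classic)
    (Lambda_disjoint : trivIset (below Lambda b%:E)
       (fun alpha => `[alpha, succ Lambda alpha[%classic))
    (z : \bar R -> E) (g : R -> E)
    (gE : forall alpha t, below Lambda b%:E alpha ->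
       (alpha <= t%:E)%E -> (t%:E < succ Lambda alpha)%E -> g t = z alpha) :
  let x := fun alpha : \bar R =>
    (fine (succ Lambda alpha) - fine alpha) *: z alpha in
  (HL_integrable a b g <-> wo_summable (below Lambda b%:E) x) /\
  (HL_integrable a b g \/ wo_summable (below Lambda b%:E) x ->
     HL_integral a b g a b = wo_sum (below Lambda b%:E) x).
Proof.
move=> x.
have sums_of f : is_HL_primitive a b g f ->
    is_partial_sums Lambda x (fun gamma => f (fine gamma) - f a).
  exact: partial_sums_of_primitive.
have summableP := wo_summable_below ab Lambda_wo Lambda_sub Lambda_min Lambda_max
  Lambda_cover x.
have integrableP : HL_integrable a b g <-> wo_summable (below Lambda b%:E) x.
  split=> [[f pf]|/summableP[tau]]; last exact: primitive_of_partial_sums.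
  by apply/summableP; eexists; exact: sums_of pf.
split=> // gx; have [f pf] : HL_integrable a b g by case: gx => // /integrableP.
have pF : is_HL_primitive a b g (xget (fun=> 0) (is_HL_primitive a b g)).
  exact: xgetI pf.
rewrite /HL_integral (wo_sum_below ab Lambda_wo Lambda_sub Lambda_min Lambda_max
  Lambda_cover (sums_of _ pF)).
by [].
Qed.
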